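(* Let $G$ be an $H(4,3)$-free graph with an even number $m \ge 24$ of edges and without isolated vertices. Then \[ \rho(G)\le \rho'(m), \] where $\rho'(m)$ is the largest real root of $p_m(x)=x^4-mx^2-(m-2)x+\frac{m}{2}-1$. Moreover, equality holds if and only if $G \cong S^{-}_{\frac{m+4}{2},2}$.
   Context: All graphs are finite, simple and undirected; $\rho(G)$ denotes the spectral radius (largest eigenvalue) of the adjacency matrix of $G$. $H(4,3)$ (the ''fish graph'') is the graph obtained from a $4$-cycle $C_4$ and a triangle $C_3$ by identifying one vertex of the $4$-cycle with one vertex of the triangle (so it has $6$ vertices and $7$ edges). A graph is $H(4,3)$-free if it contains no subgraph (not necessarily induced) isomorphic to $H(4,3)$. For $n\ge 3$, $S_{n,2}=K_2\vee (n-2)K_1$ is the graph consisting of two adjacent vertices $u,v$ together with $n-2$ further vertices each adjacent to exactly $u$ and $v$; $S^{-}_{n,2}$ is the graph obtained from $S_{n,2}$ by deleting one edge joining a vertex of degree $2$ to one of $u,v$. Thus $S^{-}_{\frac{m+4}{2},2}$ has exactly $m$ edges. *)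

(* Defs.v *)
From HB Require Import structures.
From mathcomp Require Import all_boot all_order all_algebra.
From mathcomp Require Import polyrcf.
From mathcomp Require Import reals.
Set Implicit Arguments. Unset Strict Implicit. Unset Printing Implicit Defensive.
Import Order.TTheory GRing.Theory Num.Theory.
Local Open Scope ring_scope.

Definition simple_graph (T : finType) (e : rel T) : Prop :=
  symmetric e /\ irreflexive e.

Definition edges (T : finType) (e : rel T) : {set {set T}} :=
  [set A : {set T} | [exists u, exists v, (A == [set u; v]) && e u v]].

Definition num_edges (T : finType) (e : rel T) : nat := #|edges e|.

Definition no_isolated (T : finType) (e : rel T) : Prop :=
  forall x : T, exists y : T, e x y.

(* The fish graph H(4,3): 4-cycle 0-1-2-3-0 and triangle 0-4-5-0,
   sharing vertex 0. *)
Definition fish_edge0 (i j : nat) : bool :=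
  [|| (i == 0%N) && (j == 1%N), (i == 1%N) && (j == 2%N),
      (i == 2%N) && (j == 3%N), (i == 3%N) && (j == 0%N),
      (i == 0%N) && (j == 4%N), (i == 4%N) && (j == 5%N)
    | (i == 5%N) && (j == 0%N)].

Definition fish_edge (i j : 'I_6) : bool :=
  fish_edge0 i j || fish_edge0 j i.

Definition contains_H43 (T : finType) (e : rel T) : Prop :=
  exists f : 'I_6 -> T, injective f /\
    (forall i j : 'I_6, fish_edge i j -> e (f i) (f j)).

Definition H43_free (T : finType) (e : rel T) : Prop := ~ contains_H43 e.

Definition adj_mx (R : nzRingType) (T : finType) (e : rel T) : 'M[R]_#|T| :=
  \matrix_(i, j) (e (enum_val i) (enum_val j))%:R.

(* largest real root of a polynomial over a real closed field
   (rootsR p is the increasingly sorted list of all roots of p) *)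
Definition largest_root (R : rcfType) (p : {poly R}) : R := last 0 (rootsR p).

(* spectral radius = largest eigenvalue of the adjacency matrix
   = largest real root of its characteristic polynomial *)
Definition spectral_radius (R : realType) (T : finType) (e : rel T) : R :=
  largest_root (char_poly (adj_mx R e)).

Definition p_poly (R : realType) (m : nat) : {poly R} :=
  'X^4 - (m%:R) *: 'X^2 - (m%:R - 2) *: 'X + (m%:R / 2 - 1)%:P.

Definition rho' (R : realType) (m : nat) : R := largest_root (p_poly R m).

(* S^-_{n,2} on vertex set 'I_n: u = 0, v = 1, vertices 2..n-1 adjacent to
   both u and v, except that the edge {1,2} is deleted. *)
Definition Sminus_edge0 (i j : nat) : bool :=
  [|| (i == 0%N) && (j == 1%N), (i == 0%N) && (2 <= j)%N
    | (i == 1%N) && (3 <= j)%N].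

Definition Sminus (n : nat) : rel 'I_n :=
  fun i j => Sminus_edge0 i j || Sminus_edge0 j i.

Definition isomorphic (T1 T2 : finType) (e1 : rel T1) (e2 : rel T2) : Prop :=
  exists f : T1 -> T2, bijective f /\ forall x y, e2 (f x) (f y) = e1 x y.
Arguments Sminus n : clear implicits.

(* Main.v *)
Require Import Defs.
From HB Require Import structures.
From mathcomp Require Import all_boot all_order all_algebra.
From mathcomp Require Import polyrcf reals.
From mathcomp Require Import ring lra zify.
Import Order.TTheory GRing.Theory Num.Theory.
Local Open Scope ring_scope.

(* Let [y] be the entrywise absolute value of an eigenvector for [rho], scaled so
   that its largest entry [y u] is 1; then [rho y <= A y] entrywise. Let [N] be
   the neighbourhood of [u] and [W] the set of vertices outside [N] and [u].
   Using the inequality twice at [u] bounds [rho^2] and [rho^2 - rho] from above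
   by weighted counts of the edges inside [N] and between [N] and [W], whereas
   [rho >= rho'(m)] implies [rho^2 - rho > m - 3/2]; with [m >= 24] this forces at
   least four edges inside [N]. As [G] has no fish centred at [u], the graph
   induced on [N] has no path on three vertices together with a disjoint edge,
   so its edges form a matching, lie on four vertices, or form a star. The first
   two cases contradict the bounds. In the third, [W] is empty, so [G] consists
   of [u], the centre [v] of the star, [r] common neighbours of [u] and [v], and
   [t] pendant vertices at [u]; eliminating [y] gives
   [rho^4 - m rho^2 - 2 r rho + r t <= 0], which forces [t = 1] since [m] is even. *)

(** * The polynomial [p_m] *)

Lemma le_largest_root (R : rcfType) (p : {poly R}) (x : R) :
  p != 0 -> root p x -> x <= largest_root p.
Proof.
move=> p0 rx; rewrite /largest_root.
have : x \in rootsR p by rewrite -(roots_on_rootsR p0) rx in_itv.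
have : sorted <=%R (rootsR p) by apply: (sub_sorted (@ltW _ R)); apply: sorted_roots.
elim/last_ind: (rootsR p) => // s y _ ss; rewrite last_rcons mem_rcons inE.
case/predU1P => [->//|xs].
by move: ss; rewrite (sorted_pairwise le_trans) pairwise_rcons => /andP[/allP/(_ _ xs)].
Qed.

(** [last 0] also returns 0 when there is no root at all; a nonzero value can only come from the
    list. *)
Lemma root_largest_root (R : rcfType) (p : {poly R}) :
  p != 0 -> largest_root p != 0 -> root p (largest_root p).
Proof.
move=> p0; rewrite /largest_root => l0.
suff : last 0 (rootsR p) \in rootsR p by rewrite -(roots_on_rootsR p0) => /andP[].
by case: (rootsR p) l0 => [|y s] /=; rewrite ?eqxx // mem_last.
Qed.

Lemma horner_p_poly (R : realType) (m : nat) (x : R) :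
  (p_poly R m).[x] = x ^+ 4 - m%:R * x ^+ 2 - (m%:R - 2) * x + (m%:R / 2 - 1).
Proof. by rewrite /p_poly !hornerE. Qed.

Lemma p_poly_neq0 (R : realType) (m : nat) : (4 <= m)%N -> p_poly R m != 0.
Proof.
move=> hm; apply/eqP => p0; have := horner_p_poly R m 0.
rewrite p0 horner0 => h.
have : (4 : R) <= m%:R by rewrite ler_nat.
nra.
Qed.

Lemma p_poly_large (R : realType) (m : nat) (x : R) :
  (4 <= m)%N -> m%:R <= x -> 0 < (p_poly R m).[x].
Proof.
rewrite horner_p_poly -(ler_nat R) => m4 mx.
have h2 : x * m%:R <= x ^+ 2 by rewrite expr2 ler_wpM2l //; lra.
have : 0 <= x ^+ 2 * (x ^+ 2 - x * m%:R) by apply: mulr_ge0; [exact: sqr_ge0|lra].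
have : 0 <= (x - 4) * x ^+ 2 * m%:R by rewrite !mulr_ge0 ?sqr_ge0 //; lra.
have : 0 <= (x - 4) * x * m%:R by rewrite !mulr_ge0 //; lra.
have : 0 < x * m%:R by apply: mulr_gt0; lra.
rewrite !exprS expr0; lra.
Qed.

(** A negative value at [x] would, by the intermediate value theorem, force a root beyond [x], hence
    beyond the largest one; [p_poly_large] supplies the positive end. *)
Lemma p_poly_ge0 (R : realType) (m : nat) (x : R) :
  (4 <= m)%N -> rho' R m <= x -> 0 <= (p_poly R m).[x].
Proof.
move=> m4 rx; rewrite leNgt; apply/negP => px.
pose b := Num.max x m%:R.
have xb : x <= b by rewrite /b le_max lexx.
have pb : 0 < (p_poly R m).[b] by apply: p_poly_large => //; rewrite /b le_max lexx orbT.
have [||y /itvP yI ry] := @poly_ivtoo _ (p_poly R m) x b => //.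
  by rewrite nmulr_rlt0.
have := le_largest_root _ _ _ (p_poly_neq0 R m m4) ry.
by rewrite leNgt (le_lt_trans rx) // yI.
Qed.

(* [p_m(x) = (x^2 - x - (m - 1)) (x^2 + x) + x + m/2 - 1], which is [-1/4] at
   the positive solution of [x^2 - x = m - 3/2]. *)
Lemma rho'_gt (R : realType) (m : nat) : (4 <= m)%N ->
  (1 + Num.sqrt (4 * m%:R - 5)) / 2 < rho' R m.
Proof.
move=> m4; set x := (X in X < _).
have m4R : (4 : R) <= m%:R by rewrite ler_nat.
have ge0 : 0 <= 4 * m%:R - 5 :> R by lra.
have xx : x ^+ 2 = x + m%:R - 3 / 2.
  rewrite /x; have := sqr_sqrtr ge0; rewrite !expr2; nra.
have px : (p_poly R m).[x] = - (1 / 4).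
  rewrite horner_p_poly (_ : x ^+ 4 = (x ^+ 2) ^+ 2); last by rewrite -exprM.
  rewrite xx (_ : (x + m%:R - 3 / 2) ^+ 2 =
     x ^+ 2 + 2 * x * (m%:R - 3 / 2) + (m%:R - 3 / 2) ^+ 2); last by ring.
  by rewrite xx; field.
rewrite ltNge; apply/negP => /(p_poly_ge0 _ _ _ m4); rewrite px; lra.
Qed.

(** Here [4 m - 5 >= 91 > (19/2)^2], and [21/4 = (1 + 19/2) / 2]. *)
Lemma ge_rho'_bounds (R : realType) (m : nat) (x : R) : (24 <= m)%N ->
  rho' R m <= x -> 21 / 4 < x /\ m%:R + x - 3 / 2 < x ^+ 2.
Proof.
move=> m24 rx.
have m4 : (4 <= m)%N by lia.
have m24R : (24 : R) <= m%:R by rewrite ler_nat.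
have := lt_le_trans (rho'_gt R m m4) rx.
set s := Num.sqrt _ => sx.
have ge0 : 0 <= 4 * m%:R - 5 :> R by lra.
have ss := sqr_sqrtr ge0; rewrite -/s in ss.
have s0 : 0 <= s by apply: sqrtr_ge0.
have s19 : 19 / 2 < s by rewrite ltNge; apply/negP => h; nra.
split; nra.
Qed.

Lemma root_rho' (R : realType) (m : nat) : (24 <= m)%N -> (p_poly R m).[rho' R m] = 0.
Proof.
move=> m24; apply/rootP/root_largest_root.
  by apply: p_poly_neq0; lia.
have [] := ge_rho'_bounds R m _ m24 (lexx _); rewrite /rho' => h _.
by apply/eqP => h0; move: h; rewrite h0; lra.
Qed.

(** * Eigenvectors and edge counts *)

Lemma mul_row_adj_mx (R : realType) (T : finType) (e : rel T) (f : T -> R) i :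
  symmetric e ->
  ((\row_j f (enum_val j)) *m adj_mx R e) 0 i = \sum_(z | e (enum_val i) z) f z.
Proof.
move=> esym; rewrite !mxE [RHS]big_mkcond /=.
rewrite [RHS](reindex _ (onW_bij _ (@enum_val_bij T))) /=.
apply: eq_bigr => j _; rewrite !mxE esym.
by case: ifP => _; rewrite ?mulr1 ?mulr0.
Qed.

(** Eigenvectors become functions on vertices, so later arguments never meet the enumeration of
    [T]. *)
Lemma root_char_adj_mx (R : realType) (T : finType) (e : rel T) (a : R) :
  symmetric e ->
  root (char_poly (adj_mx R e)) a <->
  exists f : T -> R, (exists x, f x != 0) /\
    forall x, \sum_(z | e x z) f z = a * f x.
Proof.
move=> esym; rewrite -eigenvalue_root_char; split.
- case/eigenvalueP=> v va v0; exists (fun x => v 0 (enum_rank x)).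
  have vE : v = \row_j v 0 (enum_rank (enum_val j)).
    by apply/rowP => j; rewrite mxE enum_valK.
  split.
    have /existsP[i vi] : [exists i, v 0 i != 0].
      apply: contraR v0 => /existsPn h; apply/eqP/rowP => i; rewrite mxE.
      by apply/eqP; move: (h i); rewrite negbK.
    by exists (enum_val i); rewrite enum_valK.
  move=> x; have := mul_row_adj_mx R T e (fun x => v 0 (enum_rank x)) (enum_rank x) esym.
  by rewrite -vE va !mxE enum_rankK => <-.
- case=> f [[x fx] fa]; apply/eigenvalueP; exists (\row_j f (enum_val j)).
    by apply/rowP => i; rewrite mul_row_adj_mx // fa !mxE.
  apply: contra fx => /eqP/rowP/(_ (enum_rank x)).
  by rewrite !mxE enum_rankK => ->.
Qed.

(* A multiple of the entrywise absolute value of any eigenvector will do, so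
   no Perron-Frobenius theory is needed. *)
Lemma spectral_radius_subharmonic (R : realType) (T : finType) (e : rel T) :
  symmetric e -> spectral_radius R e != 0 ->
  exists (y : T -> R) (u : T), y u = 1 /\ (forall x, 0 <= y x <= 1) /\
    forall x, spectral_radius R e * y x <= \sum_(z | e x z) y z.
Proof.
move=> esym r0.
have /(root_char_adj_mx R T e _ esym)[f [[x0 fx0] fr]] :=
  root_largest_root _ _ (monic_neq0 (char_poly_monic (adj_mx R e))) r0.
pose u := [arg max_(x > x0) `|f x|]%O.
have fu x : `|f x| <= `|f u|.
  by rewrite /u; case: Order.TotalTheory.arg_maxP => // i _; apply.
have u0 : 0 < `|f u| by rewrite (lt_le_trans _ (fu x0)) // normr_gt0.
exists (fun x => `|f x| / `|f u|), u; split; first by rewrite divff // gt_eqF.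
split=> [x|x]; first by rewrite divr_ge0 //= ler_pdivrMr // mul1r.
rewrite -mulr_suml mulrA ler_pM2r ?invr_gt0 //.
apply: le_trans (ler_norm_sum _ _ _); rewrite fr normrM ler_wpM2r //.
exact: ler_norm.
Qed.

(** Both sides count ordered adjacent pairs; each edge, a two-element set, comes from exactly two of
    them. *)
Lemma sum_degree (T : finType) (e : rel T) : symmetric e -> irreflexive e ->
  (\sum_x #|[set z | e x z]| = 2 * num_edges e)%N.
Proof.
move=> es eirr; rewrite /num_edges.
transitivity (\sum_(p : T * T | e p.1 p.2) 1)%N.
  rewrite -(pair_big_dep xpredT (fun x z => e x z) (fun _ _ => 1%N)) /=.
  by apply: eq_bigr => x _; rewrite sum1dep_card.
rewrite (partition_big (fun p : T * T => [set p.1; p.2]) (mem (edges e))) /=; last first.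
  case=> x z /= exz; rewrite inE; apply/existsP; exists x; apply/existsP; exists z.
  by rewrite eqxx.
rewrite mulnC -sum_nat_const; apply: eq_bigr => A.
rewrite inE => /existsP[x /existsP[z /andP[/eqP-> exz]]].
have xz : x != z by apply: contraTneq exz => ->; rewrite eirr.
rewrite sum1dep_card -[RHS](_ : #|[set (x, z); (z, x)]| = 2)%N; last first.
  by rewrite cards2 xpair_eqE negb_and xz.
apply: eq_card => -[a b]; rewrite !inE /= !xpair_eqE.
apply/andP/idP => [[eab /eqP/setP h]|].
  have ab : a != b by apply: contraTneq eab => ->; rewrite eirr.
  have := h a; have := h b; rewrite !inE !eqxx orbT /=.
  move=> /esym/orP[]/eqP hb /esym/orP[]/eqP ha; move: ab; rewrite ha hb ?eqxx ?orbT //.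
case/orP=> /andP[/eqP-> /eqP->]; first by rewrite exz eqxx.
by rewrite es exz setUC eqxx.
Qed.

(** The 4-cycle is [a b c d], the triangle [a f g], and [a] is the shared vertex. *)
Lemma H43_freeE (T : finType) (e : rel T) (a b c d f g : T) :
  symmetric e -> H43_free e -> uniq [:: a; b; c; d; f; g] ->
  e a b -> e b c -> e c d -> e d a -> e a f -> e f g -> e g a -> False.
Proof.
move=> es free us ab bc cd da af fg ga; apply: free.
exists (fun i : 'I_6 => nth a [:: a; b; c; d; f; g] i); split.
  by move=> i j /eqP; rewrite nth_uniq // => /eqP/val_inj.
have E0 (i j : 'I_6) : fish_edge0 i j ->
    e (nth a [:: a; b; c; d; f; g] i) (nth a [:: a; b; c; d; f; g] j).
  by case/or4P=> [||| /or4P[]]; case/andP=> /eqP-> /eqP->.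
by move=> i j /orP[/E0//|/E0]; rewrite es.
Qed.

(** * Graphs without a disjoint path and edge *)

Section PathEdgeFree.
Variables (T : finType) (g : rel T).
Hypotheses (gs : symmetric g) (gi : irreflexive g).
Hypothesis no_path_edge : forall a b c p q, g a b -> g b c -> g p q -> a != c ->
  p \notin [:: a; b; c] -> q \notin [:: a; b; c] -> False.

(** The path [b a c] misses the edge [p q]. *)
Lemma no_edge_across a b c d p q : uniq [:: a; b; c; d; p; q] ->
  g a b -> g c d -> g p q -> g a c -> False.
Proof.
rewrite /= !inE !negb_or -!andbA.
case/and5P => n1 n2 n3 n4 /and5P[n5 n6 n7 n8 /and5P[n9 n10 n11 n12 /and4P[n13 n14 n15 _]]].
move=> ab cd pq ac.
apply: (no_path_edge b a c p q) => //; rewrite ?inE ?negb_or; first by rewrite gs.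
  by rewrite ![p == _]eq_sym n8 n4 n11.
by rewrite ![q == _]eq_sym n9 n5 n12.
Qed.

(** The path [x y z] must meet each of the three disjoint edges, so it consists of one endpoint of
    each; its edge [x y] then joins two of them, against [no_edge_across]. *)
Lemma no_path_three_edges a b c d p q x y z : uniq [:: a; b; c; d; p; q] ->
  g a b -> g c d -> g p q -> g x y -> g y z -> x != z -> False.
Proof.
move=> U ab cd pq xy yz xz.
wlog ax : a b U ab / a \in [:: x; y; z].
  move=> h; case ax: (a \in [:: x; y; z]); first by apply: (h a b).
  case bx: (b \in [:: x; y; z]); last first.
    by apply: (no_path_edge x y z a b); rewrite ?ax ?bx.
  apply: (h b a) => //; last by rewrite gs.
  by rewrite (@perm_uniq _ _ [:: a; b; c; d; p; q]) //; apply/permP => P /=; clear; lia.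
wlog cx : c d U cd / c \in [:: x; y; z].
  move=> h; case cx: (c \in [:: x; y; z]); first by apply: (h c d).
  case dx: (d \in [:: x; y; z]); last first.
    by apply: (no_path_edge x y z c d); rewrite ?cx ?dx.
  apply: (h d c) => //; last by rewrite gs.
  by rewrite (@perm_uniq _ _ [:: a; b; c; d; p; q]) //; apply/permP => P /=; clear; lia.
wlog px : p q U pq / p \in [:: x; y; z].
  move=> h; case px: (p \in [:: x; y; z]); first by apply: (h p q).
  case qx: (q \in [:: x; y; z]); last first.
    by apply: (no_path_edge x y z p q); rewrite ?px ?qx.
  apply: (h q p) => //; last by rewrite gs.
  by rewrite (@perm_uniq _ _ [:: a; b; c; d; p; q]) //; apply/permP => P /=; clear; lia.
have ac : g a c = false by apply/negP => ac; exact: (no_edge_across _ _ _ _ _ _ U ab cd pq ac).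
have ap : g a p = false.
  apply/negP; apply: (no_edge_across a b p q c d) => //.
  by rewrite (@perm_uniq _ _ [:: a; b; c; d; p; q]) //; apply/permP => P /=; clear; lia.
have cp : g c p = false.
  apply/negP; apply: (no_edge_across c d p q a b) => //.
  by rewrite (@perm_uniq _ _ [:: a; b; c; d; p; q]) //; apply/permP => P /=; clear; lia.
have ca : g c a = false by rewrite gs.
have pa : g p a = false by rewrite gs.
have pc : g p c = false by rewrite gs.
have nac : a != c by apply: contraTneq U => ->; rewrite /= !inE eqxx ?orbT.
have nap : a != p by apply: contraTneq U => ->; rewrite /= !inE eqxx ?orbT.
have ncp : c != p by apply: contraTneq U => ->; rewrite /= !inE eqxx ?orbT ?andbF.
move: ax cx px; rewrite !inE.
case/or3P=> /eqP ?; case/or3P=> /eqP ?; case/or3P=> /eqP ?; subst => //;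
  first [by rewrite eqxx in nac | by rewrite eqxx in nap | by rewrite eqxx in ncp
       | by rewrite xy in ac | by rewrite xy in ap | by rewrite xy in cp
       | by rewrite xy in ca | by rewrite xy in pa | by rewrite xy in pc].
Qed.

(** Outside the first two cases there is a path [a b c]. If two disjoint edges exist, every edge
    lies on their four endpoints; otherwise edges pairwise meet without a common vertex and form a
    triangle, whose degree sum 6 is below 8. *)
Lemma path_edge_free_cases : (8 <= \sum_x #|[set z | g x z]|)%N ->
  [\/ forall x, (#|[set z | g x z]| <= 1)%N,
      exists v, forall x z, g x z -> x = v \/ z = v |
      exists a b c d, [/\ uniq [:: a; b; c; d], g a b, g c d &
        forall x z, g x z -> x \in [set a; b; c; d]]].
Proof.
move=> g8.
case: (boolP [forall x, (#|[set z | g x z]| <= 1)%N]) => [/forallP|]; first by constructor 1.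
case/forallPn=> b; rewrite -ltnNge => /card_gt1P[a [c []]].
rewrite !inE => ba bc ac; have ab : g a b by rewrite gs.
have gn x z : g x z -> x != z by apply: contraTneq => ->; rewrite gi.
case: (boolP [exists v, [forall x, [forall z, g x z ==> ((x == v) || (z == v))]]]).
  case/existsP=> v /forallP h; constructor 2; exists v => x z gxz.
  by have /forallP/(_ z) := h x; rewrite gxz /= => /orP[]/eqP; [left|right].
move=> nostar; constructor 3.
case: (boolP [exists s : T * T, [exists t : T * T,
    [&& g s.1 s.2, g t.1 t.2 & uniq [:: s.1; s.2; t.1; t.2]]]]).
- case/existsP=> -[s1 s2] /existsP[[t1 t2]] /= /and3P[gs12 gt12 U].
  exists s1, s2, t1, t2; split=> // x z gxz; apply: contraT => xH.
  have x_neq : [&& x != s1, x != s2, x != t1 & x != t2].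
    by move: xH; rewrite !inE !negb_or -!andbA.
  case/and4P: x_neq => xs1 xs2 xt1 xt2.
  move: (U); rewrite /= !inE !negb_or -!andbA => /and5P[n1 n2 n3 n4].
  case/and3P=> n5 n6 _.
  have [m2 m3 m4 m5] : [/\ t1 != s1, t2 != s1, t1 != s2 & t2 != s2].
    by rewrite ![t1 == _]eq_sym ![t2 == _]eq_sym.
  have [sx1 sx2 tx1 tx2] : [/\ s1 != x, s2 != x, t1 != x & t2 != x].
    by rewrite ![_ == x]eq_sym.
  case: (eqVneq z s1) => [?|zs1].
    by subst z; exfalso; apply: (no_path_edge x s1 s2 t1 t2) => //;
      rewrite !inE; do !(apply/norP; split).
  case: (eqVneq z s2) => [?|zs2].
    by subst z; exfalso; apply: (no_path_edge x s2 s1 t1 t2); rewrite // ?[g s2 s1]gs //;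
      rewrite !inE; do !(apply/norP; split).
  case: (eqVneq z t1) => [?|zt1].
    by subst z; exfalso; apply: (no_path_edge x t1 t2 s1 s2) => //;
      rewrite !inE; do !(apply/norP; split).
  case: (eqVneq z t2) => [?|zt2].
    by subst z; exfalso; apply: (no_path_edge x t2 t1 s1 s2); rewrite // ?[g t2 t1]gs //;
      rewrite !inE; do !(apply/norP; split).
  (* Now [x z] would be a third disjoint edge, which the path [a b c] rules out. *)
  exfalso; apply: (no_path_three_edges s1 s2 t1 t2 x z a b c) => //.
  by rewrite /= !inE !negb_or n1 n2 n3 n4 n5 n6 (gn _ _ gxz) ![_ == x]eq_sym
    ![_ == z]eq_sym xs1 xs2 xt1 xt2 zs1 zs2 zt1 zt2.
- move=> nodisj.
  have meet p q r s : g p q -> g r s -> [|| p == r, p == s, q == r | q == s].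
    move=> pq rs; apply: contraNT nodisj; rewrite !negb_or => /and4P[n1 n2 n3 n4].
    apply/existsP; exists (p, q); apply/existsP; exists (r, s).
    by rewrite /= !inE !negb_or pq rs n1 n2 n3 n4 !gn.
  have /existsP[p /existsP[q]] : [exists p, [exists q, [&& g p q, p != b & q != b]]].
    move: nostar => /existsPn/(_ b)/forallPn[p]/forallPn[q].
    rewrite negb_imply negb_or => h; by apply/existsP; exists p; apply/existsP; exists q.
  case/and3P=> pq pb qb.
  (* An edge avoiding [b] must meet both [a b] and [b c], so it is [a c]. *)
  have gac : g a c.
    have := meet _ _ _ _ pq ab; have := meet _ _ _ _ pq bc.
    rewrite (negPf pb) (negPf qb) /= ?orbF => /orP[]/eqP ? /orP[]/eqP ?; subst;
      by rewrite ?eqxx // in ac *; rewrite gs.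
  have inabc x z : g x z -> x \in [set a; b; c].
    move=> xz; rewrite !inE; apply: contraT; rewrite !negb_or -andbA => /and3P[xa xb xc].
    have := meet _ _ _ _ xz ab; have := meet _ _ _ _ xz bc; have := meet _ _ _ _ xz gac.
    rewrite (negPf xa) (negPf xb) (negPf xc) /= => /orP[]/eqP ? /orP[]/eqP ? /orP[]/eqP ?;
    subst; by rewrite ?eqxx ?gi in ac ab bc.
  suff : (\sum_x #|[set z | g x z]| <= 3 * 2)%N by move=> /(leq_trans g8).
  have abc3 : (#|[set a; b; c]| = 3)%N.
    by rewrite -setUA cardsU1 cards2 !inE negb_or ac (gn _ _ ab) (gn _ _ bc).
  rewrite -[X in (_ <= X * _)%N]abc3 -sum_nat_const.
  rewrite [X in (X <= _)%N](bigID (mem [set a; b; c])) /= [X in (_ + X)%N]big1 ?addn0.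
    apply: leq_sum => x xabc.
    have : ([set z | g x z] \subset [set a; b; c] :\ x).
      apply/subsetP => z; rewrite inE => xz; rewrite in_setD1 (inabc z x) 1?gs // andbT.
      by rewrite eq_sym gn.
    move/subset_leq_card/leq_trans; apply.
    by have := cardsD1 x [set a; b; c]; rewrite xabc abc3 add1n => -[<-].
  move=> x xabc; apply: eq_card0 => z; rewrite !inE; apply: contraNF xabc; exact: inabc.
Qed.
End PathEdgeFree.

(** * The extremal graph *)

Lemma isomorphic_Sminus (T : finType) (e : rel T) (u v i : T) (n : nat) :
  symmetric e -> u != v -> u != i -> v != i -> #|T| = n ->
  (forall x, e u x = (x != u)) ->
  (forall x, e v x = (x != v) && (x != i)) ->
  (forall x z, x \notin [:: u; v] -> z \notin [:: u; v] -> e x z = false) ->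
  isomorphic e (Sminus n).
Proof.
move=> es uv ui vi Tn eu ev enot.
(* Positions in this list are the labels of [Sminus]: [i] gets label 2, the vertex that lost its
   edge to 1. *)
pose s := [:: u, v, i & enum (~: [set u; v; i])].
have s_all x : x \in s by rewrite !inE mem_enum !inE; case: (x == u) (x == v) (x == i) => [] [] [].
have s_uniq : uniq s.
  by rewrite /= !inE !mem_enum !inE !eqxx ?orbT /= enum_uniq !orbF andbT negb_or uv ui vi.
have s_size : size s = n.
  by rewrite -Tn -(card_uniqP s_uniq); apply: eq_card => x; rewrite s_all.
have s_lt x : (index x s < n)%N by rewrite -s_size index_mem.
exists (fun x => Ordinal (s_lt x)); split.
  exists (fun k : 'I_n => nth u s k) => [x|k]; first by rewrite nth_index.
  by apply: val_inj; apply: index_uniq; rewrite ?s_size.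
move=> x z; rewrite /Sminus /= /Sminus_edge0.
case: (eqVneq u x) => [<-|ux]; case: (eqVneq u z) => [<-|uz].
- by rewrite eu [u == u]eqxx.
- by rewrite eu [z == u]eq_sym uz; case: (v == z) => //=; case: (i == z).
- by rewrite es eu [x == u]eq_sym ux; case: (v == x) => //=; case: (i == x).
case: (eqVneq v x) => [<-|vx]; case: (eqVneq v z) => [<-|vz] /=.
- by rewrite ev [v == v]eqxx.
- by rewrite ev ![z == _]eq_sym vz; case: (i == z).
- by rewrite es ev ![x == _]eq_sym vx; case: (i == x).
rewrite enot; first by case: (i == x); case: (i == z).
  by rewrite !inE ![x == _]eq_sym negb_or ux vx.
by rewrite !inE ![z == _]eq_sym negb_or uz vz.
Qed.

(* Eliminating [a] from [rho^2 <= rho a + r (1 + a) + t] and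
   [rho^2 a <= rho + r (1 + a)]. *)
Lemma star_elim (R : realFieldType) (rho a r t : R) :
  0 <= r -> 0 <= rho -> r < rho ^+ 2 ->
  rho ^+ 2 <= rho * a + r * (1 + a) + t ->
  rho ^+ 2 * a <= rho + r * (1 + a) ->
  rho ^+ 4 - (1 + 2 * r + t) * rho ^+ 2 - 2 * r * rho + r * t <= 0.
Proof.
move=> r0 rho0 hr h1 h2.
have k1 : rho ^+ 2 - r - t <= (rho + r) * a by lra.
have k2 : a * (rho ^+ 2 - r) <= rho + r by lra.
(* The factors are chosen so that [a] cancels in the sum of [m1] and [m2]. *)
have m1 : 0 <= ((rho + r) * a - (rho ^+ 2 - r - t)) * (rho ^+ 2 - r).
  by apply: mulr_ge0; lra.
have m2 : 0 <= (rho + r) * (rho + r - a * (rho ^+ 2 - r)) by apply: mulr_ge0; lra.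
rewrite (_ : rho ^+ 4 = rho ^+ 2 * rho ^+ 2); last by rewrite -exprD.
by rewrite !expr2 in m1 m2 *; lra.
Qed.

(* [rho^4 - m rho^2 - 2 r rho + r t] with [2 r = m - 1 - t] is [p_m rho] for
   [t = 1], and increases with [t]. *)
Lemma star_pendant (R : realFieldType) (rho : R) (m r t : nat) :
  0 <= rho -> (1 <= r)%N -> (m = 1 + 2 * r + t)%N -> ~~ odd m ->
  rho ^+ 4 - m%:R * rho ^+ 2 - 2 * r%:R * rho + r%:R * t%:R <= 0 ->
  0 <= rho ^+ 4 - m%:R * rho ^+ 2 - (m%:R - 2) * rho + (m%:R / 2 - 1) ->
  t = 1%N.
Proof.
move=> rho0 r1 mE modd h1 h2.
have mR : m%:R = 1 + 2 * r%:R + t%:R :> R by rewrite mE; ring.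
have r1R : 1 <= r%:R :> R by rewrite ler1n.
(* If [t = 0], then [m = 1 + 2 r] is odd. *)
case: (ltngtP t 1) => // t1; first by move: modd; rewrite mE; lia.
have t2 : 2 <= t%:R :> R by rewrite ler_nat.
(* The first polynomial exceeds the second by [(t - 1) (rho + r - 1/2)], which is positive for
   [t >= 2]. *)
have q1 : 0 <= (t%:R - 1) * rho by apply: mulr_ge0; lra.
have q2 : 0 <= (t%:R - 2) * (r%:R - 1) :> R by apply: mulr_ge0; lra.
by exfalso; rewrite mR in h1 h2; lra.
Qed.

(** With value 1 at vertex 0, the equation at vertex 1 determines its value [a], and the equation at
    vertex 0 becomes [p_m(x) = 0]. *)
Lemma Sminus_eigenvector (R : realType) (r m : nat) (x : R) :
  m = (2 * r + 2)%N -> 0 < x -> r%:R < x ^+ 2 -> (p_poly R m).[x] = 0 ->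
  exists f : 'I_r.+3 -> R, f ord0 = 1 /\
    forall i, \sum_(j | Sminus r.+3 i j) f j = x * f i.
Proof.
move=> mE x0 xr; rewrite horner_p_poly => px.
have mR : m%:R = 2 * r%:R + 2 :> R by rewrite mE; ring.
have xn0 : x != 0 by rewrite gt_eqF.
have xrn0 : x ^+ 2 - r%:R != 0 by rewrite subr_eq0 gt_eqF.
pose a := (x + r%:R) / (x ^+ 2 - r%:R).
have aE : a * (x ^+ 2 - r%:R) = x + r%:R by rewrite divfK.
have aE2 : a * (x + r%:R) = x ^+ 2 - r%:R - 1.
  apply: (mulIf xrn0); rewrite mulrAC aE; rewrite mR in px.
  by move: px; rewrite !exprS expr0; lra.
(* The default of [nth] is the value at the [r] common neighbours. *)
exists (fun i => nth ((1 + a) / x) [:: 1; a; x^-1] i); split=> // i.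
rewrite big_mkcond !big_ord_recl /=.
under eq_bigr do rewrite nth_default //.
case: i => [[|[|[|k]]] ik]; rewrite /Sminus /Sminus_edge0 /=.
- rewrite sumr_const card_ord -mulr_natr; apply: (mulIf xn0).
  transitivity (a * x + 1 + (1 + a) * r%:R); first by field.
  by rewrite mulr1 -expr2; lra.
- rewrite sumr_const card_ord -mulr_natr; apply: (mulIf xn0).
  transitivity (x + (1 + a) * r%:R); first by field.
  by rewrite expr2 in aE; lra.
- by rewrite big1_eq divff // !addr0.
- by rewrite big1_eq !addr0 nth_nil mulrCA divff ?mulr1.
Qed.

(** The eigenvector is pulled back along the isomorphism; applied to [rho'], this bounds the
    spectral radius of the extremal graph from below. *)
Lemma root_char_Sminus (R : realType) (T : finType) (e : rel T) (m : nat) (x : R) :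
  symmetric e -> (24 <= m)%N -> ~~ odd m -> isomorphic e (Sminus ((m + 4) %/ 2)) ->
  0 < x -> m%:R < x ^+ 2 -> (p_poly R m).[x] = 0 -> root (char_poly (adj_mx R e)) x.
Proof.
move=> es m24 modd [f [bf fE]] x0 xm px.
pose r := (m - 2)./2.
have mE : m = (2 * r + 2)%N by rewrite /r; lia.
have nE : ((m + 4) %/ 2 = r.+3)%N by rewrite /r; lia.
move: f bf fE; rewrite nE => f bf fE.
have rx : r%:R < x ^+ 2 by apply: le_lt_trans xm; rewrite ler_nat mE; lia.
have [z [z0 zE]] := Sminus_eigenvector R r m x mE x0 rx px.
apply/root_char_adj_mx => //; exists (z \o f); split.
  by have [g _ gK] := bf; exists (g ord0); rewrite /= gK z0 oner_neq0.
move=> w; rewrite /= -zE (reindex f) /=; last exact: onW_bij.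
by apply: eq_bigl => t; rewrite fE.
Qed.

(** * The neighbourhood of a maximal entry *)

Section Neighbourhood.
Variables (T : finType) (e : rel T) (u : T).
Hypotheses (es : symmetric e) (ei : irreflexive e).

Definition nbhd : {set T} := [set x | e u x].
Definition far : {set T} := ~: (u |: nbhd).
Definition degn (x : T) : nat := #|[set z in nbhd | e x z]|.
Definition degf (x : T) : nat := #|[set z in far | e x z]|.

(** Stated for any commutative monoid, as it serves both degree counts and weighted real sums. *)
Lemma big_nbhd_far (V : Type) (idx : V) (op : Monoid.com_law idx) (P : pred T)
    (F : T -> V) :
  \big[op/idx]_(x | P x) F x =
  op (if P u then F u else idx)
     (op (\big[op/idx]_(x in nbhd | P x) F x) (\big[op/idx]_(x in far | P x) F x)).
Proof.
rewrite (bigID (pred1 u)) /=; congr (op _ _).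
  rewrite (eq_bigl (fun x => (x == u) && P x)) => [|x]; last by rewrite andbC.
  by rewrite big_mkcondr big_pred1_eq.
rewrite (bigID (mem nbhd)) /=; congr (op _ _); apply: eq_bigl => x; rewrite !inE.
  by case: eqVneq => [->|_]; rewrite ?ei ?andbF //= andbT andbC.
by rewrite negb_or -andbA andbC.
Qed.

Lemma degree_split x : #|[set z | e x z]| = (e x u + (degn x + degf x))%N.
Proof.
rewrite -sum1dep_card big_nbhd_far /=; congr (_ + (_ + _))%N.
  by rewrite sum1dep_card.
by rewrite sum1dep_card.
Qed.

Lemma exchange_degree (A B : {set T}) :
  (\sum_(x in A) #|[set z in B | e x z]| = \sum_(x in B) #|[set z in A | e x z]|)%N.
Proof.
under eq_bigr do rewrite -sum1dep_card.
under [RHS]eq_bigr do rewrite -sum1dep_card.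
rewrite (exchange_big_dep (mem B)) /=; last by move=> ? ? _ /andP[].
apply: eq_bigr => z zB; apply: eq_bigl => x.
by rewrite zB es.
Qed.

(** Degrees are summed over [u], [nbhd] and [far]. Edges inside either set are already counted twice
    by [degn] or [degf]; the others receive the factor 2. *)
Lemma num_edges_split :
  (2 * num_edges e = 2 * #|nbhd| + \sum_(x in nbhd) degn x
    + 2 * \sum_(x in far) degn x + \sum_(x in far) degf x)%N.
Proof.
rewrite -sum_degree // (big_nbhd_far _ _ _ xpredT) /=.
have -> : (\sum_(x in nbhd | true) #|[set z | e x z]| =
    #|nbhd| + \sum_(x in nbhd) degn x + \sum_(x in far) degn x)%N.
  rewrite (exchange_degree far nbhd) -sum1_card -!big_split /=.
  apply: eq_big => [x|x]; rewrite andbT // inE degree_split es => ->.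
  by rewrite addnA.
have -> : (\sum_(x in far | true) #|[set z | e x z]| =
    \sum_(x in far) degn x + \sum_(x in far) degf x)%N.
  rewrite -!big_split /=; apply: eq_big => [x|x]; rewrite andbT // degree_split.
  by rewrite !inE negb_or es => /andP[_ /negPf->].
rewrite -/nbhd; lia.
Qed.

(** The graph induced on the neighbourhood, kept as a relation on all of [T] so that
    [path_edge_free_cases] applies without a subtype. *)
Definition nedge (x z : T) : bool := [&& e u x, e u z & e x z].

Lemma nedge_sym : symmetric nedge.
Proof. by move=> x z; rewrite /nedge andbCA (es x). Qed.

Lemma nedge_neq x z : nedge x z -> x != z.
Proof. by case/and3P=> _ _; apply: contraTneq => ->; rewrite ei. Qed.

Lemma degnE x : x \in nbhd -> degn x = #|[set z | nedge x z]|.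
Proof.
by rewrite inE => ux; apply: eq_card => z; rewrite !inE /nedge ux.
Qed.

Hypothesis free : H43_free e.

Lemma nbhd_neq x : e u x -> u != x.
Proof. by apply: contraTneq => <-; rewrite ei. Qed.

(** The 4-cycle [u a b c] and the triangle [u p q] would form a fish. *)
Lemma no_path_and_edge a b c p q : nedge a b -> nedge b c -> nedge p q ->
  a != c -> p \notin [:: a; b; c] -> q \notin [:: a; b; c] -> False.
Proof.
move=> ab bc pq ac; rewrite !inE !negb_or => /and3P[pa pb pc] /and3P[qa qb qc].
have [[ab' bc'] pq'] := (nedge_neq _ _ ab, nedge_neq _ _ bc, nedge_neq _ _ pq).
case/and3P: ab => ua ub eab; case/and3P: bc => _ uc ebc; case/and3P: pq => up uq epq.
apply: (H43_freeE T e u a b c p q) => //; last by rewrite es.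
  rewrite /= !inE !negb_or !nbhd_neq // ac ab' bc' pq' ![_ == p]eq_sym ![_ == q]eq_sym.
  by rewrite pa pb pc qa qb qc.
by rewrite es.
Qed.

(** Two such neighbours [c], [d] of [w] would give the 4-cycle [u c w d], meeting the triangle
    [u a b] only in [u]. *)
Lemma far_nbhd_outside a b w : nedge a b -> w \in far ->
  (#|[set z in nbhd | e w z] :\ a :\ b| <= 1)%N.
Proof.
move=> ab; rewrite leqNgt !inE negb_or => /andP[wu uw]; apply/card_gt1P => -[c [d []]].
rewrite !inE => /and4P[cb ca uc wc] /and4P[db da ud wd] cd.
have ab' := nedge_neq _ _ ab; case/and3P: ab => ua ub eab.
have wN x : e u x -> w != x by apply: contraTneq => <-.
apply: (H43_freeE T e u c w d a b) => //; try by rewrite es.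
rewrite /= !inE !negb_or [u == w]eq_sym wu [c == w]eq_sym !wN // !nbhd_neq //.
by rewrite cd ca cb da db ab'.
Qed.

(** * Weighted edge counts for a subharmonic vector *)

Variables (R : realType) (rho : R) (y : T -> R).
Hypotheses (yu : y u = 1) (y01 : forall x, 0 <= y x <= 1).
Hypothesis sub : forall x, rho * y x <= \sum_(z | e x z) y z.

Local Notation N := nbhd.
Local Notation W := far.
Local Notation dN := degn.
Local Notation dW := degf.
(** [sumN] and [sumW] are twice the numbers of edges inside [N] and [W]; [K] counts the edges
    between them, and [S] weighs each of those by the entry at its end in [W]. *)
Local Notation sumN := (\sum_(x in N) dN x)%N.
Local Notation K := (\sum_(w in W) dN w)%N.
Local Notation sumW := (\sum_(w in W) dW w)%N.
Local Notation S := (\sum_(w in W) (dN w)%:R * y w).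

Lemma y_ge0 x : 0 <= y x. Proof. by case/andP: (y01 x). Qed.
Lemma y_le1 x : y x <= 1. Proof. by case/andP: (y01 x). Qed.

Lemma rho_le_sum_nbhd : rho <= \sum_(x in N) y x.
Proof.
have := sub u; rewrite yu mulr1 => /le_trans; apply.
by rewrite le_eqVlt; apply/orP; left; apply/eqP/eq_bigl => x; rewrite inE.
Qed.

Lemma sum_le_card (A : {set T}) (f : T -> nat) :
  \sum_(x in A) (f x)%:R * y x <= (\sum_(x in A) f x)%:R.
Proof. by rewrite natr_sum; apply: ler_sum => x _; rewrite ler_piMr // y_le1. Qed.

Lemma exchange_sum (A B : {set T}) :
  \sum_(x in A) \sum_(z in B | e x z) y z =
  \sum_(z in B) #|[set x in A | e z x]|%:R * y z.
Proof.
rewrite (exchange_big_dep (mem B)) /=; last by move=> ? ? _ /andP[].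
apply: eq_bigr => z zB; rewrite -sum1dep_card natr_sum mulr_suml.
by apply: eq_big => [x|x _]; rewrite ?mul1r // zB es.
Qed.

Lemma subharmonic_nbhd x : x \in N ->
  rho * y x <= 1 + (\sum_(z in N | e x z) y z + \sum_(z in W | e x z) y z).
Proof.
rewrite inE => ux; apply: le_trans (sub x) _.
by rewrite big_nbhd_far /= es ux yu.
Qed.

Lemma subharmonic_far w : w \in W -> rho * y w <= (dN w)%:R + (dW w)%:R.
Proof.
rewrite !inE negb_or => /andP[_ uw]; apply: le_trans (sub w) _.
rewrite big_nbhd_far /= es (negPf uw) add0r /degn /degf -!sum1dep_card.
by rewrite !natr_sum; apply: lerD; apply: ler_sum => z _; apply: y_le1.
Qed.

(** The inequality is summed over the neighbours of [u]; exchanging sums makes each entry appear as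
    often as its vertex has neighbours in [N]. *)
Lemma rho_sum_nbhd :
  rho * \sum_(x in N) y x <= #|N|%:R + \sum_(x in N) (dN x)%:R * y x + S.
Proof.
rewrite mulr_sumr; apply: le_trans (ler_sum _ (fun x xN => subharmonic_nbhd x xN)) _.
by rewrite !big_split /= !exchange_sum sumr_const addrA.
Qed.

(** Improves on [S <= K] when [rho] is larger than [c], at the cost of the edges inside [W]. *)
Lemma rho_far_sum (c : nat) : (forall w, w \in W -> (dN w <= c)%N) ->
  rho * S <= c%:R * (K%:R + sumW%:R).
Proof.
move=> dc; rewrite -natrD -big_split natr_sum !mulr_sumr; apply: ler_sum => w wW.
rewrite mulrCA natrD; apply: le_trans (_ : (dN w)%:R * ((dN w)%:R + (dW w)%:R) <= _).
  by rewrite ler_wpM2l // subharmonic_far.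
by rewrite ler_wpM2r ?addr_ge0 // ler_nat dc.
Qed.

Hypothesis rho_gt : 21 / 4 < rho.
Hypothesis rho2 : (num_edges e)%:R + rho - 3 / 2 < rho ^+ 2.

Lemma num_edges_splitR :
  2 * (num_edges e)%:R = 2 * #|N|%:R + sumN%:R + 2 * K%:R + sumW%:R :> R.
Proof. by rewrite -!natrM -!natrD -num_edges_split. Qed.

Lemma far_sum_le : S <= K%:R. Proof. exact: sum_le_card. Qed.

Lemma far_sum_ge0 : 0 <= S.
Proof. by apply: sumr_ge0 => w _; rewrite mulr_ge0 ?y_ge0. Qed.

Lemma rho_sqr_le :
  rho ^+ 2 <= #|N|%:R + \sum_(x in N) (dN x)%:R * y x + S.
Proof.
apply: le_trans rho_sum_nbhd; rewrite expr2 ler_wpM2l ?rho_le_sum_nbhd //.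
by have := rho_gt; lra.
Qed.

(** With [Y] the sum over [N], [rho <= Y] gives [rho^2 - rho <= rho Y - Y], which lowers every
    degree coefficient by 1. *)
Lemma rho_sqr_sub_le :
  rho ^+ 2 - rho <= #|N|%:R + \sum_(x in N) ((dN x)%:R - 1) * y x + S.
Proof.
have h := rho_sum_nbhd; have h' := rho_le_sum_nbhd.
under eq_bigr do rewrite mulrBl mul1r.
rewrite sumrB; set Y := \sum_(x in N) y x; rewrite -/Y in h h'.
have : 0 <= (rho - 1) * (Y - rho) by apply: mulr_ge0; have := rho_gt; lra.
rewrite expr2; lra.
Qed.

(** Comparing [m + rho - 3/2 < rho^2 <= |N| + sumN + K] with the edge count gives
    [sumW + 2 rho - 3 < sumN], and [2 (21/4) - 3 = 15/2]. *)
Lemma sum_far_le_sum_nbhd : sumW%:R + 15 / 2 < sumN%:R :> R.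
Proof.
have := rho_sqr_le; have := sum_le_card N dN; have := far_sum_le.
have := num_edges_splitR; have := rho2; have := rho_gt; lra.
Qed.

Lemma sum_nbhd_ge8 : (8 <= sumN)%N.
Proof.
have h : (0 : R) <= sumW%:R by []; have := sum_far_le_sum_nbhd.
move=> h2; have : (7 : R) < sumN%:R by lra.
by rewrite ltr_nat.
Qed.

(** No coefficient [dN x - 1] is positive, so [rho^2 - rho <= |N| + K], whereas [m - 3/2] is larger
    because [sumN >= 8]. *)
Lemma matching_nbhd : (forall x, x \in N -> (dN x <= 1)%N) -> False.
Proof.
move=> d1; have := rho_sqr_sub_le.
have : \sum_(x in N) ((dN x)%:R - 1) * y x <= 0.
  apply: sumr_le0 => x xN; rewrite mulr_le0_ge0 ?y_ge0 //.
  by rewrite subr_le0 -[1]/(1%:R) ler_nat d1.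
have := sum_far_le_sum_nbhd; have := num_edges_splitR; have := rho2; have := rho_gt.
have := far_sum_le; have h : (0 : R) <= sumW%:R by []; lra.
Qed.

(** Degrees inside [N] are at most 3 on [H] and vanish off it, so [rho^2 <= |N| + 3 Y + S], where
    summing the inequality over [H] gives [rho Y <= 4 + 3 Y + S]. *)
Lemma four_vertices_nbhd a b c d : uniq [:: a; b; c; d] ->
  nedge a b -> nedge c d ->
  (forall x z, nedge x z -> x \in [set a; b; c; d]) -> False.
Proof.
move=> U ab cd inH; set H := [set a; b; c; d] in inH.
have H4 : #|H| = 4%N.
  move: U; rewrite /= !inE !negb_or -!andbA => /and5P[n1 n2 n3 n4] /and3P[n5 n6 _].
  by rewrite /H -!setUA !cardsU1 cards1 !inE !negb_or n1 n2 n3 n4 n5 n6.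
have HN : H \subset N.
  case/and3P: ab cd => ua ub _ /and3P[uc ud _]; apply/subsetP => x; rewrite !inE.
  by rewrite -!orbA => /or4P[] /eqP->.
have H3 x : x \in H -> (#|H :\ x| = 3)%N.
  by move=> xH; have := cardsD1 x H; rewrite xH H4 add1n => -[<-].
have d3 x : x \in N -> (dN x <= 3 * (x \in H))%N.
  move=> xN; rewrite degnE //; case: (boolP (x \in H)) (inH x) => xH.
    move=> _; rewrite muln1 -(H3 x xH); apply/subset_leq_card/subsetP => z.
    rewrite inE in_setD1 nedge_sym // => zx; rewrite (inH z x) // andbT.
    by apply: nedge_neq zx.
  by move=> h; rewrite muln0 leqn0; apply/eqP/eq_card0 => z; rewrite inE; apply/negP => /h.
have sumH (F : T -> R) : \sum_(x in N) (x \in H)%:R * F x = \sum_(x in H) F x.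
  rewrite big_mkcond [RHS]big_mkcond; apply: eq_bigr => x _.
  case: (boolP (x \in H)) => [xH|_]; first by rewrite (subsetP HN _ xH) mul1r.
  by rewrite mul0r if_same.
set Y := \sum_(x in H) y x.
have Y0 : 0 <= Y by apply: sumr_ge0 => x _; apply: y_ge0.
have dY : \sum_(x in N) (dN x)%:R * y x <= 3 * Y.
  rewrite /Y -sumH mulr_sumr; apply: ler_sum => x xN.
  by rewrite mulrA -natrM ler_wpM2r ?y_ge0 // ler_nat d3.
have rY : rho * Y <= 4 + (3 * Y + S).
  rewrite /Y mulr_sumr.
  apply: le_trans (ler_sum _ (fun x xH => subharmonic_nbhd x (subsetP HN x xH))) _.
  rewrite !big_split /= !exchange_sum sumr_const H4 lerD2l.
  have cardHN z : (#|[set x in H | e z x]| <= dN z)%N.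
    apply/subset_leq_card/subsetP => x; rewrite inE => /andP[xH zx].
    by rewrite inE (subsetP HN _ xH).
  apply: lerD.
    apply: le_trans dY; apply: ler_sum => x xN.
    by rewrite ler_wpM2r ?y_ge0 // ler_nat cardHN.
  by apply: ler_sum => x xN; rewrite ler_wpM2r ?y_ge0 // ler_nat cardHN.
(* At most one neighbour of [w] in [N] lies off [{a, b}] and at most one off [{c, d}]; these pairs
   are disjoint, so every neighbour is off one of them. *)
have dN2 w : w \in W -> (dN w <= 2)%N.
  move=> wW; have := far_nbhd_outside a b w ab wW.
  have := far_nbhd_outside c d w cd wW.
  rewrite /degn; set A := [set z in N | e w z] => h1 h2.
  have : A \subset (A :\ a :\ b) :|: (A :\ c :\ d).
    apply/subsetP => x xA; rewrite !(in_setU, in_setD1) xA !andbT.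
    apply: contraLR U; rewrite negb_or !negb_and !negbK.
    case/andP=> /orP[]/eqP xE /orP[]/eqP xE'; rewrite -xE -xE' /= !inE eqxx;
    by rewrite ?orbT ?andbF.
  move/subset_leq_card/leq_trans; apply.
  by apply: leq_trans (leq_card_setU _ _) _; apply: (leq_add h2 h1).
have rS := rho_far_sum 2 dN2.
have S0 := far_sum_ge0.
have K0 : (0 : R) <= K%:R by [].
have D8 : (8 : R) <= sumN%:R by rewrite ler_nat sum_nbhd_ge8.
have D12 : sumN%:R <= 12 :> R.
  rewrite ler_nat; apply: leq_trans (leq_sum _ (fun x xN => d3 x xN)) _.
  rewrite -big_distrr /= (_ : 12 = 3 * #|H|)%N; last by rewrite H4.
  rewrite leq_mul2l /= -sum1_card.
  rewrite big_mkcond [X in (_ <= X)%N]big_mkcond; apply: leq_sum => x _.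
  by case: (x \in N); case: (x \in H).
have rY' : 0 <= (rho - 21 / 4) * Y by apply: mulr_ge0 => //; have := rho_gt; lra.
have rS' : 0 <= (rho - 21 / 4) * S by apply: mulr_ge0 => //; have := rho_gt; lra.
(* [sumN <= 12] gives [sumW < 9/2]; with [Y <= 4 (4 + S) / 9] and [S <= 8 (K + sumW) / 21], the
   bound on [rho^2] falls below [m + rho - 3/2]. *)
have := sum_far_le_sum_nbhd; have := num_edges_splitR; have := rho2; have := rho_gt.
have := rho_sqr_le; have := far_sum_le.
lra.
Qed.

(** * The case of a star in the neighbourhood *)

Hypothesis noiso : no_isolated e.

Section Star.
Variable v : T.
Hypothesis star : forall x z, nedge x z -> x = v \/ z = v.

Lemma star_center : v \in N.
Proof.
have D8 := sum_nbhd_ge8.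
case: (boolP (v \in N)) => // vN; move: D8; rewrite big1 // => x xN.
rewrite degnE //; apply: eq_card0 => z; rewrite inE; apply/negP => xz.
have /and3P[ux uz _] := xz.
by case: (star _ _ xz) => E; move: vN; rewrite inE -E ?ux ?uz.
Qed.

Lemma star_degn x : x \in N -> x != v -> dN x = nedge v x.
Proof.
move=> xN xv; rewrite degnE //.
transitivity #|[set z | (z == v) && nedge v x]|.
  apply: eq_card => z; rewrite !inE; case: (eqVneq z v) => [->|zv] /=.
    by rewrite nedge_sym.
  by apply/negP => /star[] E; [move: xv|move: zv]; rewrite E eqxx.
case: (nedge v x); first by rewrite (eq_card (_ : _ =i pred1 v)) ?card1 // => z; rewrite !inE andbT.
by apply: eq_card0 => z; rewrite !inE andbF.
Qed.

Lemma star_sum : sumN = (2 * dN v)%N.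
Proof.
rewrite (bigD1 v) ?star_center //= mul2n -addnn; congr addn.
rewrite degnE ?star_center // -sum1dep_card.
rewrite big_mkcond [RHS]big_mkcond; apply: eq_bigr => x _.
case: (boolP (x \in N)) => xN /=; last first.
  by case: ifP => // /and3P[_ ux _]; move: xN; rewrite inE ux.
case: (eqVneq x v) => [->|xv] /=; last by rewrite star_degn //; case: nedge.
by case: ifP => // /(nedge_neq _ _); rewrite eqxx.
Qed.

Lemma star_ge4 : (4 <= dN v)%N.
Proof.
have := sum_nbhd_ge8.
by rewrite star_sum; lia.
Qed.

(** If [w] had two neighbours [c], [d] in [N] besides [v], one of the at least four leaves, [l],
    would differ from both, and [far_nbhd_outside] applies to the edge [v l]. *)
Lemma star_far_degn w : w \in W -> (dN w <= 2)%N.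
Proof.
move=> wW; rewrite /degn (cardsD1 v); set A := [set z in N | e w z].
suff : (#|A :\ v| <= 1)%N by case: (v \in A) => /=; lia.
rewrite leqNgt; apply/card_gt1P => -[c [d [cA dA cd]]].
have : (0 < #|[set l | nedge v l] :\ c :\ d|)%N.
  have := star_ge4; rewrite degnE ?star_center //.
  rewrite (cardsD1 c) (cardsD1 d (_ :\ c)).
  by case: (c \in _); case: (d \in _) => /=; lia.
case/card_gt0P=> l; rewrite !inE => /and3P[ld lc vl].
have := far_nbhd_outside v l w vl wW.
rewrite -/A leqNgt => /card_gt1P; apply; exists c, d; split=> //.
  by rewrite in_setD1 cA andbT eq_sym.
by rewrite in_setD1 dA andbT eq_sym.
Qed.

(** Only [v] can contribute positively to [rho_sqr_sub_le], so [K + sumW / 2 < S + 1/2]. Then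
    [S <= K] forces [sumW = 0], [rho S <= 2 K] forces [K = 0], and a vertex of [W] would be
    isolated. *)
Lemma star_far : W = set0.
Proof.
have h1 := rho_sqr_sub_le.
have h2 := num_edges_splitR.
have h3 := far_sum_le.
have h4 := rho_far_sum 2 star_far_degn.
have h5 := far_sum_ge0.
have h6 : \sum_(x in N) ((dN x)%:R - 1) * y x <= (dN v)%:R - 1.
  rewrite (bigD1 v) ?star_center //= -[leRHS]addr0; apply: lerD.
    rewrite ler_piMr ?y_le1 // subr_ge0 ler1n.
    by apply: leq_trans star_ge4.
  apply: sumr_le0 => x /andP[xN xv]; rewrite mulr_le0_ge0 ?y_ge0 //.
  by rewrite star_degn //; case: nedge; rewrite ?subrr // sub0r oppr_le0.
have h7 : 0 <= (rho - 21 / 4) * S by apply: mulr_ge0 => //; have := rho_gt; lra.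
rewrite star_sum natrM in h2.
have sW : sumW = 0%N.
  apply/eqP; rewrite -leqn0 leqNgt -(ltr_nat R); apply/negP => hW.
  have : (1 : R) <= sumW%:R by rewrite ler1n -(ltr_nat R).
  by have := rho2; lra.
have sK : K = 0%N.
  apply/eqP; rewrite -leqn0 leqNgt -(ltr_nat R); apply/negP => hK.
  have : (1 : R) <= K%:R by rewrite ler1n -(ltr_nat R).
  by rewrite sW in h2 h4; have := rho2; lra.
apply/setP => w; rewrite [RHS]inE; apply/negP => wW.
have [z wz] := noiso w.
have : (0 < #|[set z | e w z]|)%N by apply/card_gt0P; exists z; rewrite inE.
rewrite degree_split.
move/eqP: sW; rewrite sum_nat_eq0 => /forall_inP/(_ w wW)/eqP->.
move/eqP: sK; rewrite sum_nat_eq0 => /forall_inP/(_ w wW)/eqP->.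
by move: wW; rewrite !inE negb_or es => /andP[_ /negPf->].
Qed.

(** [L] holds the common neighbours of [u] and [v], [I] the pendant vertices at [u]; their sizes are
    [r] and [t] in [star_elim]. *)
Local Notation L := [set x | nedge v x].
Local Notation I := (N :\ v :\: L).

Lemma star_leaves : L \subset N :\ v.
Proof.
apply/subsetP => x; rewrite inE in_setD1 => vx.
by rewrite eq_sym (nedge_neq v x vx); case/and3P: vx => _ ux _; rewrite inE ux.
Qed.

Lemma star_card_nbhd : #|N| = (1 + (#|L| + #|I|))%N.
Proof.
rewrite (cardsD1 v) star_center; congr addn.
by rewrite -(cardsID L) (setIidPr star_leaves).
Qed.

Lemma star_num_edges : num_edges e = (1 + 2 * #|L| + #|I|)%N.
Proof.
have := num_edges_split; rewrite star_sum star_far !big_set0 star_card_nbhd.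
by rewrite degnE ?star_center //; lia.
Qed.

(** The inequalities at [u] and [v], multiplied by [rho], and those summed over [L] and [I] yield
    the hypotheses of [star_elim] with [a = y v]. *)
Lemma star_ineq :
  rho ^+ 4 - (num_edges e)%:R * rho ^+ 2 - 2 * #|L|%:R * rho + #|L|%:R * #|I|%:R <= 0.
Proof.
have mE : (num_edges e)%:R = 1 + 2 * #|L|%:R + #|I|%:R :> R.
  by rewrite star_num_edges; ring.
have L0 : (0 : R) <= #|L|%:R by [].
have I0 : (0 : R) <= #|I|%:R by [].
have subN x : x \in N -> rho * y x <= 1 + \sum_(z in N | e x z) y z.
  move=> /subharmonic_nbhd.
  by rewrite star_far [X in _ + (_ + X)]big_pred0 ?addr0 // => z; rewrite inE.
have hv : rho * y v <= 1 + \sum_(l in L) y l.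
  apply: le_trans (subN _ star_center) _; rewrite lerD2l le_eqVlt; apply/orP; left.
  by apply/eqP/eq_bigl => x; have := star_center; rewrite !inE /nedge => ->.
have nb x : x \in N :\ v -> \sum_(z in N | e x z) y z = (nedge v x)%:R * y v.
  rewrite in_setD1 => /andP[xv xN].
  rewrite (eq_bigl (fun z => (z == v) && nedge v x)); last first.
    move=> z; case: (eqVneq z v) => [->|zv] /=.
      by have := star_center; move: xN; rewrite !inE /nedge (es x v) => -> ->.
    apply/negP => /andP[zN xz]; have : nedge x z.
      by move: zN xN; rewrite !inE /nedge xz => -> ->.
    by case/star => E; [move: xv|move: zv]; rewrite E eqxx.
  by case: nedge; rewrite ?mul1r ?mul0r; under eq_bigl do rewrite ?andbT ?andbF;
    rewrite ?big_pred1_eq ?big_pred0_eq.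
have hL : rho * \sum_(l in L) y l <= #|L|%:R * (1 + y v).
  rewrite mulr_sumr mulr_natl -sumr_const; apply: ler_sum => x xL.
  have xN := subsetP star_leaves x xL.
  apply: le_trans (subN x _) _; first by move: xN; rewrite in_setD1 => /andP[].
  by rewrite nb //; move: xL; rewrite inE => ->; rewrite mul1r.
have hI : rho * \sum_(l in I) y l <= #|I|%:R.
  rewrite mulr_sumr -sumr_const; apply: ler_sum => x; rewrite in_setD => /andP[xL xN].
  apply: le_trans (subN x _) _; first by move: xN; rewrite in_setD1 => /andP[].
  by rewrite nb //; move: xL; rewrite inE => /negPf->; rewrite mul0r addr0.
have hN : rho <= y v + (\sum_(l in L) y l + \sum_(l in I) y l).
  apply: le_trans rho_le_sum_nbhd _.
  rewrite (bigD1 v) ?star_center //= lerD2l.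
  rewrite (eq_bigl (mem (N :\ v))); last by move=> x; rewrite !inE andbC.
  by rewrite (big_setID L) /= (setIidPr star_leaves).
have rho0 : 0 <= rho by have := rho_gt; lra.
rewrite mE; apply: (star_elim R rho (y v)) => //.
- by have := rho2; have := rho_gt; rewrite mE; lra.
- have : rho * rho <= rho * (y v + (\sum_(l in L) y l + \sum_(l in I) y l)).
    by rewrite ler_wpM2l.
  by rewrite expr2; lra.
- have : rho * (rho * y v) <= rho * (1 + \sum_(l in L) y l) by rewrite ler_wpM2l.
  by rewrite expr2; lra.
Qed.

Lemma star_isomorphic : #|I| = 1%N -> isomorphic e (Sminus ((num_edges e + 4) %/ 2)).
Proof.
move=> I1; have /cards1P[i Ii] : #|I| == 1%N by rewrite I1.
have allN x : (x == u) || (x \in N).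
  have : x \notin W by rewrite star_far inE.
  by rewrite !inE negbK.
have eu x : e u x = (x != u).
  by have := allN x; rewrite inE; case: eqVneq => [->|_] //=; rewrite ei.
have /setP/(_ i) := Ii; rewrite inE eqxx in_setD in_setD1 => /and3P[iL iv iN].
have uv : u != v by have := star_center; rewrite inE eu eq_sym.
have ui : u != i by move: iN; rewrite inE eu eq_sym.
apply: (isomorphic_Sminus T e u v i) => //; first by rewrite eq_sym.
(* There are [|L| + 3] vertices and [m = 2 |L| + 2] edges. *)
- have /(congr1 (fun A : {set T} => #|A|)) : setT = u |: N.
    by apply/setP => x; rewrite in_setU in_set1 allN inE.
  rewrite cardsT cardsU1 inE ei star_card_nbhd I1 => ->.
  by rewrite star_num_edges I1; lia.
- move=> x; case: (eqVneq x v) => [->|xv]; first by rewrite ei.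
  case: (eqVneq x u) => [->|xu] /=.
    by rewrite es eu eq_sym uv.
  have /setP/(_ x) := Ii; rewrite in_setD in_setD1 in_set1 inE xv.
  by rewrite /nedge !eu xu eq_sym uv inE eu xu /= andbT => <-; rewrite negbK.
- move=> x z; rewrite !inE !negb_or => /andP[xu xv] /andP[zu zv].
  apply/negP => xz; have : nedge x z by rewrite /nedge !eu xu zu.
  by case/star => E; [move: xv|move: zv]; rewrite E eqxx.
Qed.
End Star.

(** As [p_poly_ge0] gives the opposite sign, the first conclusion makes [rho] a root, hence at most
    [rho']. *)
Lemma subharmonic_extremal :
  ~~ odd (num_edges e) -> (24 <= num_edges e)%N -> rho' R (num_edges e) <= rho ->
  (p_poly R (num_edges e)).[rho] <= 0 /\
  isomorphic e (Sminus ((num_edges e + 4) %/ 2)%N).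
Proof.
move=> modd m24 rr.
have ni : irreflexive nedge.
  by move=> x; apply/negP => /nedge_neq; rewrite eqxx.
have n8 : (8 <= \sum_x #|[set z | nedge x z]|)%N.
  apply: leq_trans sum_nbhd_ge8 _.
  rewrite [X in (X <= _)%N]big_mkcond /=; apply: leq_sum => x _.
  by case: ifP => // xN; rewrite degnE.
have np := no_path_and_edge.
case: (path_edge_free_cases T _ nedge_sym ni np n8) => [d1|[v star]|].
- exfalso.
  apply: matching_nbhd => x xN.
  by rewrite degnE.
- have st := star_ineq v star.
  have ne := star_num_edges v star.
  have p0 : 0 <= (p_poly R (num_edges e)).[rho] by apply: p_poly_ge0 => //; lia.
  rewrite horner_p_poly in p0 *.
  have rho0 : 0 <= rho by have := rho_gt; lra.
  have r1 : (0 < #|[set x | nedge v x]|)%N.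
    have := star_ge4 v star.
    rewrite degnE; first by case: #|_|.
    exact: (star_center v star).
  have I1 := star_pendant R rho _ _ _ rho0 r1 ne modd st p0.
  split.
    (* For [t = 1] the star inequality is exactly [p_m(rho) <= 0]. *)
    have mE : (num_edges e)%:R = 2 + 2 * #|[set x | nedge v x]|%:R :> R.
      by rewrite ne I1; ring.
    by rewrite I1 mE in st; rewrite mE; lra.
  exact: (star_isomorphic v star).
- case=> a [b [c [d [U ab cd inH]]]]; exfalso.
  exact: (four_vertices_nbhd a b c d).
Qed.

End Neighbourhood.

(** * The bound on the spectral radius and the case of equality *)

Theorem theorem1p1 (R : realType) (T : finType) (e : rel T) :
  simple_graph e -> H43_free e -> no_isolated e ->
  ~~ odd (num_edges e) -> (24 <= num_edges e)%N ->
  spectral_radius R e <= rho' R (num_edges e) /\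
  (spectral_radius R e = rho' R (num_edges e) <->
   isomorphic e (Sminus ((num_edges e + 4) %/ 2)%N)).
Proof.
case=> es ei free noiso modd m24.
have [r_gt r_sqr] := ge_rho'_bounds R _ _ m24 (lexx _).
have charn0 := monic_neq0 (char_poly_monic (adj_mx R e)).
have key : rho' R (num_edges e) <= spectral_radius R e ->
    (p_poly R (num_edges e)).[spectral_radius R e] <= 0 /\
    isomorphic e (Sminus ((num_edges e + 4) %/ 2)%N).
  move=> le_r.
  have [|y [u [yu [y01 sub]]]] := spectral_radius_subharmonic R T e es.
    by rewrite gt_eqF //; lra.
  have [r_gt' r_sqr'] := ge_rho'_bounds R _ _ m24 le_r.
  exact: (subharmonic_extremal T e u es ei free R _ y).
have le_rho : spectral_radius R e <= rho' R (num_edges e).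
  rewrite leNgt; apply/negP => gt_r; have [p_le0 _] := key (ltW gt_r).
  have p_root : root (p_poly R (num_edges e)) (spectral_radius R e).
    by rewrite rootE eq_le p_le0 p_poly_ge0 ?(ltW gt_r) //; lia.
  have := le_largest_root _ _ _ (p_poly_neq0 R (num_edges e) _) p_root.
  rewrite -/(rho' R _) leNgt gt_r => h; suff: false by []; apply: h; lia.
split=> //; split=> [E|iso]; first by case: key; rewrite // E.
(* Conversely, [rho'] is an eigenvalue of the extremal graph, hence at most its spectral radius. *)
apply/eqP; rewrite eq_le le_rho; apply: le_largest_root => //.
apply: (root_char_Sminus R T e (num_edges e)) => //; first by lra.
  by lra.
exact: root_rho'.
Qed.
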